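(* Let $(\tilde L,\tilde\alpha,\tilde\pi,[,],D)$ be a $\mathrm D$-Lie algebra where $A$ is Noetherian and $\tilde L$ is finitely generated as a left $A$-module. Then the rings $\tilde U^{\otimes}(\tilde L)$ and $\tilde U^{\rho}(\tilde L)$ are almost commutative unital Noetherian rings.
   Context: Let $k\to A$ be a unital homomorphism of commutative unital rings. An $A\otimes_kA$-module $M$ is regarded as having commuting left and right actions $am=(a\otimes 1)m$, $ma=(1\otimes a)m$. A 2-cocycle $f\in Z^2(\mathrm{Der}_k(A),A)$ is an alternating $A$-bilinear map with $x(f(y,z))-y(f(x,z))+z(f(x,y))-f([x,y],z)+f([x,z],y)-f([y,z],x)=0$. For such a fixed $f$, $D^1_f(A)=A\oplus\mathrm{Der}_k(A)$, with elements $aI+x$, has actions $c(aI+x)=(ca)I+cx$, $(aI+x)c=(ac+x(c))I+cx$, bracket $[aI+x,bI+y]=(x(b)-y(a)+f(x,y))I+[x,y]$, and projection $\pi(aI+x)=x$. $\mathrm{Der}_k(A)$ carries the trivial right $A$-module structure (right action equal to left action). A $\mathrm D$-Lie algebra is a 5-tuple $(\tilde L,\tilde\alpha,\tilde\pi,[,],D)$ where $\tilde L$ is an $A\otimes_kA$-module and a $k$-Lie algebra, $\tilde\alpha:\tilde L\to D^1_f(A)$ and $\tilde\pi:\tilde L\to\mathrm{Der}_k(A)$ are maps of $A\otimes_kA$-modules and $k$-Lie algebras with $\pi\circ\tilde\alpha=\tilde\pi$, $D\in\tilde L$ is central for the Lie bracket, $\tilde\pi(D)=0$, and for all $u,v\in\tilde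 L$, $c\in A$: $uc=cu+\tilde\pi(u)(c)D$ and $[u,cv]=c[u,v]+\tilde\pi(u)(c)v$. Let $T^*_k(\tilde L)$ be the tensor algebra of $\tilde L$ over $k$. $U^{\otimes}(\tilde L)=T^*_k(\tilde L)/J_1$, where $J_1$ is the 2-sided ideal generated by $D-1$, $au-(aD)\otimes u$, $vb-v\otimes(bD)$; $U^{\rho}(\tilde L)=T^*_k(\tilde L)/J_2$, where $J_2$ is the 2-sided ideal generated by $D-1$, $au-(aD)\otimes u$, $v\otimes(bD)-(bD)\otimes v-\tilde\pi(v)(b)D$ (for all $a,b\in A$, $u,v\in\tilde L$). $\tilde U^{\otimes}(\tilde L)$ and $\tilde U^{\rho}(\tilde L)$ are the quotients of $U^{\otimes}(\tilde L)$ and $U^{\rho}(\tilde L)$ by the 2-sided ideals generated by the images of $u\otimes v-v\otimes u-[u,v]$, $u,v\in\tilde L$. They are filtered by the images of $\bigoplus_{j\le i}\tilde L^{\otimes_k j}$, $i\ge0$. A ring $U$ with an exhaustive increasing multiplicative filtration $U_0\subseteq U_1\subseteq\cdots$ is almost commutative if $xy-yx\in U_{i+j-1}$ for all $x\in U_i,y\in U_j$ (with $U_{-1}=0$). *)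

(* Defs.v *)
From HB Require Import structures.
From mathcomp Require Import all_boot all_order all_algebra.
From mathcomp Require Import generic_quotient ring_quotient.
From mathcomp Require Import ring.
From mathcomp Require Import boolp classical_sets functions.

Set Implicit Arguments.
Unset Strict Implicit.
Unset Printing Implicit Defensive.

Import GRing.Theory.

Local Open Scope ring_scope.
Local Open Scope classical_set_scope.
Local Open Scope quotient_scope.

(* Commutative unital rings are [comPzRingType]s: the zero ring is allowed,
   both for k and A and for the enveloping rings, which do vanish if D = 0. *)

Section Noetherian.

Record left_ideal (R : pzRingType) (I : set R) : Prop := LeftIdeal {
  left_ideal0 : I 0;
  left_idealB : forall x y, I x -> I y -> I (x - y);
  left_idealM : forall a x, I x -> I (a * x) }.

Definition left_noetherian (R : pzRingType) : Prop :=
  forall I : set R, left_ideal I ->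
    exists n (g : 'I_n -> R),
      I = [set x | exists c : 'I_n -> R, x = \sum_(i < n) c i * g i].

(* [R^c] is the opposite ring, so its left ideals are the right ideals of R. *)
Definition noetherian (R : pzRingType) : Prop :=
  left_noetherian R /\ left_noetherian R^c.

Definition finitely_generated (A : pzRingType) (M : lmodType A) : Prop :=
  exists n (g : 'I_n -> M),
    forall u : M, exists c : 'I_n -> A, u = \sum_(i < n) c i *: g i.

End Noetherian.

Record almost_commutative (R : pzRingType) (F : nat -> set R) : Prop :=
  AlmostCommutative {
  filt0 : forall i, F i 0;
  filtB : forall i x y, F i x -> F i y -> F i (x - y);
  filt1 : F 0%N 1;
  filt_incr : forall i, F i `<=` F i.+1;
  filt_exhaustive : forall x, exists i, F i x;
  filtM : forall i j x y, F i x -> F j y -> F (i + j)%N (x * y);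
  (* the case i + j = 0 encodes the convention F_{-1} = 0 *)
  filt_comm : forall i j x y, F i x -> F j y ->
    (if (i + j)%N is m.+1 then F m else [set 0]) (x * y - y * x) }.

Record two_sided_ideal (R : pzRingType) (I : set R) : Prop := TwoSidedIdeal {
  tsideal0 : I 0;
  tsidealB : forall x y, I x -> I y -> I (x - y);
  tsidealMl : forall a x, I x -> I (a * x);
  tsidealMr : forall a x, I x -> I (x * a) }.

Section QuotientRing.

Variables (R : pzRingType) (S : set R).

Definition ideal_gen : set R := smallest (@two_sided_ideal R) S.

Lemma ideal_genP : two_sided_ideal ideal_gen.
Proof.
split.
- by move=> I [HI _]; exact: tsideal0.
- by move=> x y Hx Hy I HI; apply: (tsidealB HI.1); [exact: Hx|exact: Hy].
- by move=> a x Hx I HI; apply: (tsidealMl HI.1); exact: Hx.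
- by move=> a x Hx I HI; apply: (tsidealMr HI.1); exact: Hx.
Qed.

Definition ideal_pred : {pred R} := fun x => `[< ideal_gen x >].

Lemma ideal_pred_zmod_closed : zmod_closed ideal_pred.
Proof.
split; first by apply/asboolP; exact: tsideal0 ideal_genP.
by move=> x y /asboolP Hx /asboolP Hy; apply/asboolP; exact: (tsidealB ideal_genP).
Qed.

HB.instance Definition _ :=
  GRing.isZmodClosed.Build R ideal_pred ideal_pred_zmod_closed.

Definition quot_ring : Type := Quotient.quot ideal_pred.
HB.instance Definition _ := GRing.Zmodule.on quot_ring.

Definition quot_proj (x : R) : quot_ring := \pi_(Quotient.quot ideal_pred) x.

Lemma quot_projP x y : quot_proj x = quot_proj y <-> ideal_gen (x - y).
Proof.
split=> [/eqP|H]; rewrite /quot_proj.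
  by rewrite -Quotient.idealrBE => /asboolP.
by apply/eqP; rewrite -Quotient.idealrBE; apply/asboolP.
Qed.

Lemma quot_proj_surj q : exists x, quot_proj x = q.
Proof. by exists (repr q); exact: reprK. Qed.

Definition quot_one : quot_ring := quot_proj 1.
Definition quot_mul (p q : quot_ring) : quot_ring :=
  quot_proj (repr p * repr q).

Lemma quot_projD x y : quot_proj (x + y) = quot_proj x + quot_proj y.
Proof. by rewrite /quot_proj !piE. Qed.

Lemma quot_projN x : quot_proj (- x) = - quot_proj x.
Proof. by rewrite /quot_proj !piE. Qed.

Lemma quot_projM x y : quot_proj (x * y) = quot_mul (quot_proj x) (quot_proj y).
Proof.
have HI := ideal_genP.
apply/quot_projP.
set x' := repr _; set y' := repr _.
have Hx : ideal_gen (x - x') by apply/quot_projP; rewrite /x' [RHS]reprK.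
have Hy : ideal_gen (y - y') by apply/quot_projP; rewrite /y' [RHS]reprK.
have -> : x * y - x' * y' = (x - x') * y - x' * (y' - y).
  by rewrite mulrBl mulrBr opprB addrA subrK.
apply: (tsidealB HI); first exact: (tsidealMr HI).
apply: (tsidealMl HI); rewrite -opprB -sub0r.
by apply: (tsidealB HI) => //; exact: tsideal0.
Qed.

Fact quot_mulA : associative quot_mul.
Proof.
move=> p q r.
have [x <-] := quot_proj_surj p; have [y <-] := quot_proj_surj q.
by have [z <-] := quot_proj_surj r; rewrite -!quot_projM mulrA.
Qed.

Fact quot_mul1 : left_id quot_one quot_mul.
Proof. by move=> p; have [x <-] := quot_proj_surj p; rewrite -quot_projM mul1r. Qed.

Fact quot_mulr1 : right_id quot_one quot_mul.
Proof. by move=> p; have [x <-] := quot_proj_surj p; rewrite -quot_projM mulr1. Qed.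

Fact quot_mulDl : left_distributive quot_mul +%R.
Proof.
move=> p q r.
have [x <-] := quot_proj_surj p; have [y <-] := quot_proj_surj q.
by have [z <-] := quot_proj_surj r; rewrite -quot_projD -!quot_projM mulrDl quot_projD.
Qed.

Fact quot_mulDr : right_distributive quot_mul +%R.
Proof.
move=> p q r.
have [x <-] := quot_proj_surj p; have [y <-] := quot_proj_surj q.
by have [z <-] := quot_proj_surj r; rewrite -quot_projD -!quot_projM mulrDr quot_projD.
Qed.

HB.instance Definition _ := GRing.Zmodule_isPzRing.Build quot_ring
  quot_mulA quot_mul1 quot_mulr1 quot_mulDl quot_mulDr.

Fact quot_proj_is_zmod_morphism : zmod_morphism quot_proj.
Proof. by move=> x y; rewrite quot_projD quot_projN. Qed.
HB.instance Definition _ :=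
  GRing.isZmodMorphism.Build R quot_ring quot_proj quot_proj_is_zmod_morphism.

Fact quot_proj_is_monoid_morphism : monoid_morphism quot_proj.
Proof. by split=> // x y; rewrite quot_projM. Qed.
HB.instance Definition _ :=
  GRing.isMonoidMorphism.Build R quot_ring quot_proj quot_proj_is_monoid_morphism.

End QuotientRing.

(* The tensor algebra T(M) of the k-module M.

   Noncommutative polynomial expressions in the elements of M with coefficients
   in k, modulo the congruence generated by the axioms of unital associative
   k-algebras and the k-linearity of M -> T(M).  The universal property is
   [tensor_algebra_universal]. *)

Section TensorAlgebra.

Variables (k : comPzRingType) (M : lmodType k).

Inductive tensor_expr : Type :=
| TScal of k
| TGen of M
| TAdd of tensor_expr & tensor_expr
| TMul of tensor_expr & tensor_expr.

HB.instance Definition _ := gen_eqMixin tensor_expr.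
HB.instance Definition _ := gen_choiceMixin tensor_expr.

Inductive tensor_eq : tensor_expr -> tensor_expr -> Prop :=
| teq_refl s : tensor_eq s s
| teq_sym s t : tensor_eq s t -> tensor_eq t s
| teq_trans s t r : tensor_eq s t -> tensor_eq t r -> tensor_eq s r
| teq_congD s s' t t' :
    tensor_eq s s' -> tensor_eq t t' -> tensor_eq (TAdd s t) (TAdd s' t')
| teq_congM s s' t t' :
    tensor_eq s s' -> tensor_eq t t' -> tensor_eq (TMul s t) (TMul s' t')
| teq_addA s t r : tensor_eq (TAdd s (TAdd t r)) (TAdd (TAdd s t) r)
| teq_addC s t : tensor_eq (TAdd s t) (TAdd t s)
| teq_add0 s : tensor_eq (TAdd (TScal 0) s) s
| teq_mulA s t r : tensor_eq (TMul s (TMul t r)) (TMul (TMul s t) r)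
| teq_mul1 s : tensor_eq (TMul (TScal 1) s) s
| teq_mulr1 s : tensor_eq (TMul s (TScal 1)) s
| teq_mul0 s : tensor_eq (TMul (TScal 0) s) (TScal 0)
| teq_mulDl s t r : tensor_eq (TMul (TAdd s t) r) (TAdd (TMul s r) (TMul t r))
| teq_mulDr s t r : tensor_eq (TMul s (TAdd t r)) (TAdd (TMul s t) (TMul s r))
| teq_scalD c d : tensor_eq (TScal (c + d)) (TAdd (TScal c) (TScal d))
| teq_scalM c d : tensor_eq (TScal (c * d)) (TMul (TScal c) (TScal d))
| teq_scalC c s : tensor_eq (TMul (TScal c) s) (TMul s (TScal c))
| teq_genD u v : tensor_eq (TGen (u + v)) (TAdd (TGen u) (TGen v))
| teq_genZ c u : tensor_eq (TGen (c *: u)) (TMul (TScal c) (TGen u)).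

Definition tensor_eqb (s t : tensor_expr) : bool := `[< tensor_eq s t >].

Fact tensor_eqb_equiv : equiv_class_of tensor_eqb.
Proof.
split.
- by move=> s; apply/asboolP; exact: teq_refl.
- by move=> s t; apply/asboolP/asboolP; exact: teq_sym.
- by move=> t s r /asboolP st /asboolP tr; apply/asboolP; exact: teq_trans st tr.
Qed.

Canonical tensor_eqb_rel := EquivRelPack tensor_eqb_equiv.
Canonical tensor_eqb_encModRel := defaultEncModRel tensor_eqb.

Definition tensor_algebra : Type := {eq_quot tensor_eqb}.
HB.instance Definition _ := Choice.on tensor_algebra.

Definition tensor_class (s : tensor_expr) : tensor_algebra :=
  \pi_{eq_quot tensor_eqb} s.

Definition tensor_scal (c : k) : tensor_algebra := tensor_class (TScal c).
Definition tensor_gen (u : M) : tensor_algebra := tensor_class (TGen u).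
Definition tensor_add (p q : tensor_algebra) : tensor_algebra :=
  tensor_class (TAdd (repr p) (repr q)).
Definition tensor_mul (p q : tensor_algebra) : tensor_algebra :=
  tensor_class (TMul (repr p) (repr q)).
Definition tensor_opp (p : tensor_algebra) : tensor_algebra :=
  tensor_mul (tensor_scal (- 1)) p.

Lemma tensor_classP s t : tensor_class s = tensor_class t <-> tensor_eq s t.
Proof.
split=> [/eqP|H]; rewrite /tensor_class; first by rewrite piE => /asboolP.
by apply/eqP; rewrite piE; apply/asboolP.
Qed.

Lemma tensor_class_surj p : exists s, tensor_class s = p.
Proof. by exists (repr p); exact: reprK. Qed.

Lemma tensor_repr s : tensor_eq (repr (tensor_class s)) s.
Proof. by apply/tensor_classP; exact: reprK. Qed.

Lemma tensor_classD s t :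
  tensor_class (TAdd s t) = tensor_add (tensor_class s) (tensor_class t).
Proof. by apply/esym/tensor_classP; apply: teq_congD; exact: tensor_repr. Qed.

Lemma tensor_classM s t :
  tensor_class (TMul s t) = tensor_mul (tensor_class s) (tensor_class t).
Proof. by apply/esym/tensor_classP; apply: teq_congM; exact: tensor_repr. Qed.

Let tensorE := (tensor_classD, tensor_classM).

Fact tensor_addA : associative tensor_add.
Proof.
move=> p q r; have [s <-] := tensor_class_surj p.
have [t <-] := tensor_class_surj q; have [w <-] := tensor_class_surj r.
by rewrite -!tensorE; apply/tensor_classP; exact: teq_addA.
Qed.

Fact tensor_addC : commutative tensor_add.
Proof.
move=> p q; have [s <-] := tensor_class_surj p.
have [t <-] := tensor_class_surj q.
by rewrite -!tensorE; apply/tensor_classP; exact: teq_addC.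
Qed.

Fact tensor_add0 : left_id (tensor_scal 0) tensor_add.
Proof.
move=> p; have [s <-] := tensor_class_surj p.
by rewrite -!tensorE; apply/tensor_classP; exact: teq_add0.
Qed.

Fact tensor_mulA : associative tensor_mul.
Proof.
move=> p q r; have [s <-] := tensor_class_surj p.
have [t <-] := tensor_class_surj q; have [w <-] := tensor_class_surj r.
by rewrite -!tensorE; apply/tensor_classP; exact: teq_mulA.
Qed.

Fact tensor_mul1 : left_id (tensor_scal 1) tensor_mul.
Proof.
move=> p; have [s <-] := tensor_class_surj p.
by rewrite -!tensorE; apply/tensor_classP; exact: teq_mul1.
Qed.

Fact tensor_mulr1 : right_id (tensor_scal 1) tensor_mul.
Proof.
move=> p; have [s <-] := tensor_class_surj p.
by rewrite -!tensorE; apply/tensor_classP; exact: teq_mulr1.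
Qed.

Fact tensor_mulDl : left_distributive tensor_mul tensor_add.
Proof.
move=> p q r; have [s <-] := tensor_class_surj p.
have [t <-] := tensor_class_surj q; have [w <-] := tensor_class_surj r.
by rewrite -!tensorE; apply/tensor_classP; exact: teq_mulDl.
Qed.

Fact tensor_mulDr : right_distributive tensor_mul tensor_add.
Proof.
move=> p q r; have [s <-] := tensor_class_surj p.
have [t <-] := tensor_class_surj q; have [w <-] := tensor_class_surj r.
by rewrite -!tensorE; apply/tensor_classP; exact: teq_mulDr.
Qed.

Fact tensor_addN : left_inverse (tensor_scal 0) tensor_opp tensor_add.
Proof.
move=> p; rewrite -[X in tensor_add _ X]tensor_mul1 -tensor_mulDl.
rewrite -[tensor_add _ _]tensor_classD.
have -> : tensor_class (TAdd (TScal (- 1)) (TScal 1)) = tensor_class (TScal 0).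
  by apply/tensor_classP; rewrite -(addNr 1); exact/teq_sym/teq_scalD.
have [s <-] := tensor_class_surj p.
by rewrite -!tensorE; apply/tensor_classP; exact: teq_mul0.
Qed.

HB.instance Definition _ := GRing.isZmodule.Build tensor_algebra
  tensor_addA tensor_addC tensor_add0 tensor_addN.
HB.instance Definition _ := GRing.Zmodule_isPzRing.Build tensor_algebra
  tensor_mulA tensor_mul1 tensor_mulr1 tensor_mulDl tensor_mulDr.

Fact tensor_scalD c d : tensor_scal (c + d) = tensor_scal c + tensor_scal d.
Proof. by rewrite -[RHS]tensor_classD; apply/tensor_classP; exact: teq_scalD. Qed.

Fact tensor_scal_is_zmod_morphism : zmod_morphism tensor_scal.
Proof. by move=> c d; apply/eqP; rewrite eq_sym subr_eq -tensor_scalD subrK. Qed.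
HB.instance Definition _ := GRing.isZmodMorphism.Build k tensor_algebra
  tensor_scal tensor_scal_is_zmod_morphism.

Fact tensor_scal_is_monoid_morphism : monoid_morphism tensor_scal.
Proof.
split=> // c d.
by rewrite -[RHS]tensor_classM; apply/tensor_classP; exact: teq_scalM.
Qed.
HB.instance Definition _ := GRing.isMonoidMorphism.Build k tensor_algebra
  tensor_scal tensor_scal_is_monoid_morphism.

Lemma tensor_scalC c p : tensor_scal c * p = p * tensor_scal c.
Proof.
have [s <-] := tensor_class_surj p.
by rewrite -[LHS]tensor_classM -[RHS]tensor_classM; apply/tensor_classP; exact: teq_scalC.
Qed.

Lemma tensor_genD u v : tensor_gen (u + v) = tensor_gen u + tensor_gen v.
Proof. by rewrite -[RHS]tensor_classD; apply/tensor_classP; exact: teq_genD. Qed.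

Lemma tensor_genZ c u : tensor_gen (c *: u) = tensor_scal c * tensor_gen u.
Proof. by rewrite -[RHS]tensor_classM; apply/tensor_classP; exact: teq_genZ. Qed.

Theorem tensor_algebra_universal (B : pzRingType) (h : {rmorphism k -> B})
    (hC : forall c b, h c * b = b * h c) (g : M -> B)
    (gD : forall u v, g (u + v) = g u + g v)
    (gZ : forall c u, g (c *: u) = h c * g u) :
  exists G : {rmorphism tensor_algebra -> B},
    [/\ forall c, G (tensor_scal c) = h c,
        forall u, G (tensor_gen u) = g u
      & forall G' : {rmorphism tensor_algebra -> B},
          (forall c, G' (tensor_scal c) = h c) ->
          (forall u, G' (tensor_gen u) = g u) -> G =1 G'].
Proof.
pose ev := fix ev s : B := match s with
  | TScal c => h c | TGen u => g u
  | TAdd s t => ev s + ev t | TMul s t => ev s * ev t end.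
have evP s t : tensor_eq s t -> ev s = ev t.
  elim=> //= *; try congruence;
    by rewrite ?rmorph0 ?rmorph1 ?rmorphD ?rmorphM
       ?addrA ?add0r ?mulrA ?mul1r ?mulr1 ?mul0r ?mulrDl ?mulrDr //= 1?addrC.
pose G (p : tensor_algebra) : B := ev (repr p).
have GE s : G (tensor_class s) = ev s by apply: evP; exact: tensor_repr.
have GD p q : G (p + q) = G p + G q by exact: GE.
have Gz : zmod_morphism G.
  move=> p q; apply/eqP; rewrite eq_sym subr_eq -GD subrK //.
have Gm : monoid_morphism G.
  by split=> [|p q]; [rewrite [LHS]GE /= rmorph1|exact: GE].
pose G1 := GRing.isZmodMorphism.Build _ _ G Gz.
pose G2 := GRing.isMonoidMorphism.Build _ _ G Gm.
pose GG : {rmorphism tensor_algebra -> B} := HB.pack G G1 G2.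
exists GG; split=> [x|x|G' Gs Gg p]; [exact: GE|exact: GE|].
have [s <-] := tensor_class_surj p; rewrite [LHS]GE.
elim: s => [c|u|s IHs t IHt|s IHs t IHt] /=.
- by rewrite -Gs.
- by rewrite -Gg.
- by rewrite IHs IHt -rmorphD; congr (G' _); rewrite tensor_classD.
- by rewrite IHs IHt -rmorphM; congr (G' _); rewrite tensor_classM.
Qed.

(* The image of the sum over j <= i of the j-th tensor powers of M, that is, the
   k-span of the products of at most i elements of M. *)
Definition tensor_filt (i : nat) : set tensor_algebra :=
  [set t | exists n (c : 'I_n -> k) (w : 'I_n -> seq M),
     (forall l, (size (w l) <= i)%N) /\
     t = \sum_(l < n) tensor_scal (c l) * \prod_(u <- w l) tensor_gen u].

End TensorAlgebra.

Record lie_algebra (k : comPzRingType) (M : lmodType k) (br : M -> M -> M) :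
    Prop := LieAlgebra {
  lie_linearl : forall c x y z, br (c *: x + y) z = c *: br x z + br y z;
  lie_linearr : forall c x y z, br z (c *: x + y) = c *: br z x + br z y;
  lie_alt : forall x, br x x = 0;
  lie_jacobi : forall x y z, br x (br y z) + br y (br z x) + br z (br x y) = 0 }.

(* An A-module regarded as a k-module through phi : k -> A. *)
Section RestrictionOfScalars.

Variables (k A : comPzRingType) (phi : {rmorphism k -> A}) (M : lmodType A).

Definition restr_scalars of {rmorphism k -> A} : Type := M.
Local Notation Mk := (restr_scalars phi).
HB.instance Definition _ := GRing.Zmodule.on Mk.

Definition restr_scale (c : k) (u : Mk) : Mk := phi c *: (u : M).

Fact restr_scaleA a b v : restr_scale a (restr_scale b v) = restr_scale (a * b) v.
Proof. by rewrite /restr_scale scalerA rmorphM. Qed.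
Fact restr_scale1 : left_id 1 restr_scale.
Proof. by move=> v; rewrite /restr_scale rmorph1 scale1r. Qed.
Fact restr_scaleDr : right_distributive restr_scale +%R.
Proof. by move=> a u v; exact: scalerDr. Qed.
Fact restr_scaleDl v : {morph restr_scale^~ v : a b / a + b}.
Proof. by move=> a b; rewrite /restr_scale rmorphD; exact: scalerDl. Qed.

HB.instance Definition _ := GRing.Zmodule_isLmodule.Build k Mk
  restr_scaleA restr_scale1 restr_scaleDr restr_scaleDl.

End RestrictionOfScalars.

Section Derivations.

Variables (k A : comPzRingType) (phi : {rmorphism k -> A}).

Record derivation (x : A -> A) : Prop := Derivation {
  derivationD : forall a b, x (a + b) = x a + x b;
  derivationZ : forall c a, x (phi c * a) = phi c * x a;
  derivationM : forall a b, x (a * b) = a * x b + x a * b }.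

Definition derivation_pred : {pred A -> A^o} := fun x => `[< derivation x >].

Fact derivation_submod_closed : submod_closed derivation_pred.
Proof.
split=> [|c x y /asboolP Hx /asboolP Hy]; apply/asboolP; split.
- by move=> a b; rewrite -[LHS]/(0 : A) -[RHS]/(0 + 0 : A) addr0.
- by move=> d a; rewrite -[LHS]/(0 : A) -[RHS]/(phi d * 0 : A) mulr0.
- by move=> a b; rewrite -[LHS]/(0 : A) -[RHS]/(a * 0 + 0 * b : A) mulr0 mul0r addr0.
- move=> a b; rewrite -[LHS]/(c * x (a + b) + y (a + b) : A) (derivationD Hx) (derivationD Hy).
  by rewrite -[RHS]/((c * x a + y a) + (c * x b + y b) : A) mulrDr addrACA.
- move=> d a; rewrite -[LHS]/(c * x (phi d * a) + y (phi d * a) : A).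
  rewrite (derivationZ Hx) (derivationZ Hy).
  by rewrite -[RHS]/(phi d * (c * x a + y a) : A) mulrDr mulrCA.
- move=> a b; rewrite -[LHS]/(c * x (a * b) + y (a * b) : A).
  rewrite (derivationM Hx) (derivationM Hy).
  by rewrite -[RHS]/(a * (c * x b + y b) + (c * x a + y a) * b : A); ring.
Qed.

HB.instance Definition _ :=
  GRing.isSubmodClosed.Build A (A -> A^o) derivation_pred derivation_submod_closed.

Record Der : Type := MkDer {
  der_fun :> A -> A^o;
  der_funP : der_fun \in derivation_pred }.

HB.instance Definition _ := [isSub for der_fun].
HB.instance Definition _ := [Choice of Der by <:].
HB.instance Definition _ := [SubChoice_isSubLmodule of Der by <:].

Lemma der_scaleE (c : A) (x : Der) a : (c *: x) a = c * x a.
Proof. by []. Qed.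

Definition der_comm (x y : Der) (a : A) : A := x (y a) - y (x a).

Fact der_commP x y : (der_comm x y : A -> A^o) \in derivation_pred.
Proof.
have /asboolP Hx := der_funP x; have /asboolP Hy := der_funP y.
apply/asboolP; rewrite /der_comm; split.
- by move=> a b; rewrite (derivationD Hx) (derivationD Hy) (derivationD Hx) (derivationD Hy); ring.
- by move=> c a; rewrite (derivationZ Hx) (derivationZ Hy) (derivationZ Hx) (derivationZ Hy); ring.
- move=> a b; rewrite (derivationM Hx) (derivationM Hy) (derivationD Hx) (derivationD Hy).
  by rewrite !(derivationM Hx) !(derivationM Hy); ring.
Qed.

Definition der_bracket (x y : Der) : Der := MkDer (der_commP x y).

End Derivations.

Section DLieAlgebras.

Variables (k A : comPzRingType) (phi : {rmorphism k -> A}).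

Record cocycle2 (f : Der phi -> Der phi -> A) : Prop := Cocycle2 {
  cocycle_linearl : forall (c : A) x y z, f (c *: x + y) z = c * f x z + f y z;
  cocycle_linearr : forall (c : A) x y z, f z (c *: x + y) = c * f z x + f z y;
  cocycle_alt : forall x, f x x = 0;
  cocycle_closed : forall x y z : Der phi,
    x (f y z) - y (f x z) + z (f x y)
    - f (der_bracket x y) z + f (der_bracket x z) y - f (der_bracket y z) x
    = 0 }.

(* An A (x)_k A-module structure on M extending a left A-module structure, i.e.
   a right action commuting with the left one and agreeing with it on k. *)
Record bimodule (M : lmodType A) (ract : M -> A -> M) : Prop := Bimodule {
  ractDl : forall u v a, ract (u + v) a = ract u a + ract v a;
  ractDr : forall u a b, ract u (a + b) = ract u a + ract u b;
  ractA : forall u a b, ract (ract u a) b = ract u (a * b);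
  ract1 : forall u, ract u 1 = u;
  ract_scaleC : forall a u b, ract (a *: u) b = a *: ract u b;
  ract_k : forall u c, ract u (phi c) = phi c *: u }.

(* D^1_f(A): the pair (a, x) stands for aI + x.  The left action is the
   componentwise scaling of the product A-module. *)
Definition D1 : Type := (A^o * Der phi)%type.
HB.instance Definition _ := GRing.Lmodule.on D1.

Definition D1_proj (u : D1) : Der phi := u.2.
Definition D1_ract (u : D1) (c : A) : D1 := (u.1 * c + u.2 c, c *: u.2).
Definition D1_bracket (f : Der phi -> Der phi -> A) (u v : D1) : D1 :=
  (u.2 v.1 - v.2 u.1 + f u.2 v.2, der_bracket u.2 v.2).

Record DLie (f : Der phi -> Der phi -> A) : Type := MkDLie {
  dl_mod :> lmodType A;
  dl_ract : dl_mod -> A -> dl_mod;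
  dl_bimod : bimodule dl_ract;
  dl_bracket : dl_mod -> dl_mod -> dl_mod;
  dl_lie : @lie_algebra k (restr_scalars dl_mod phi) dl_bracket;
  dl_alpha : {linear dl_mod -> D1};
  dl_alpha_ract : forall u c, dl_alpha (dl_ract u c) = D1_ract (dl_alpha u) c;
  dl_alpha_bracket : forall u v,
    dl_alpha (dl_bracket u v) = D1_bracket f (dl_alpha u) (dl_alpha v);
  dl_pi : {linear dl_mod -> Der phi};
  (* the right action on Der_k(A) equals the left one *)
  dl_pi_ract : forall u c, dl_pi (dl_ract u c) = c *: dl_pi u;
  dl_pi_bracket : forall u v,
    dl_pi (dl_bracket u v) = der_bracket (dl_pi u) (dl_pi v);
  dl_pi_alpha : forall u, D1_proj (dl_alpha u) = dl_pi u;
  dl_D : dl_mod;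
  dl_D_central : forall u, dl_bracket dl_D u = 0;
  dl_pi_D : dl_pi dl_D = 0;
  dl_ractE : forall u (c : A), dl_ract u c = c *: u + dl_pi u c *: dl_D;
  dl_leibniz : forall u v (c : A),
    dl_bracket u (c *: v) = c *: dl_bracket u v + dl_pi u c *: v }.

End DLieAlgebras.

Section UniversalRings.

Variables (k A : comPzRingType) (phi : {rmorphism k -> A}).
Variables (f : Der phi -> Der phi -> A) (L : DLie f).

Definition TL : Type := tensor_algebra (restr_scalars L phi).
HB.instance Definition _ := GRing.PzRing.on TL.

Definition TL_gen (u : L) : TL := @tensor_gen k (restr_scalars L phi) u.
Definition TL_filt (i : nat) : set TL :=
  @tensor_filt k (restr_scalars L phi) i.

Local Notation t_ := TL_gen.
Local Notation D := (dl_D L).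

Definition J1_gens : set TL :=
  [set t_ D - 1]
  `|` [set t | exists (a : A) (u : L), t = t_ (a *: u) - t_ (a *: D) * t_ u]
  `|` [set t | exists (b : A) (v : L), t = t_ (dl_ract v b) - t_ v * t_ (b *: D)].

Definition J2_gens : set TL :=
  [set t_ D - 1]
  `|` [set t | exists (a : A) (u : L), t = t_ (a *: u) - t_ (a *: D) * t_ u]
  `|` [set t | exists (b : A) (v : L),
        t = t_ v * t_ (b *: D) - t_ (b *: D) * t_ v - t_ (dl_pi L v b *: D)].

Definition Lie_gens : set TL :=
  [set t | exists u v : L, t = t_ u * t_ v - t_ v * t_ u - t_ (dl_bracket u v)].

(* Uten = U^{\otimes}(L) and Urho = U^\rho(L); the prefix t stands for the tilde
   in their quotients tUten and tUrho. *)
Definition Uten : Type := quot_ring J1_gens.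
HB.instance Definition _ := GRing.PzRing.on Uten.
Definition Urho : Type := quot_ring J2_gens.
HB.instance Definition _ := GRing.PzRing.on Urho.

Definition Uten_proj : TL -> Uten := @quot_proj TL J1_gens.
Definition Urho_proj : TL -> Urho := @quot_proj TL J2_gens.

Definition tUten : Type := quot_ring (Uten_proj @` Lie_gens).
HB.instance Definition _ := GRing.PzRing.on tUten.
Definition tUrho : Type := quot_ring (Urho_proj @` Lie_gens).
HB.instance Definition _ := GRing.PzRing.on tUrho.

Definition tUten_proj : Uten -> tUten := @quot_proj Uten (Uten_proj @` Lie_gens).
Definition tUrho_proj : Urho -> tUrho := @quot_proj Urho (Urho_proj @` Lie_gens).

Definition tUten_filt (i : nat) : set tUten :=
  tUten_proj @` (Uten_proj @` TL_filt i).
Definition tUrho_filt (i : nat) : set tUrho :=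
  tUrho_proj @` (Urho_proj @` TL_filt i).

End UniversalRings.

(* Main.v *)
(* In both rings U the map a |-> aD is a ring homomorphism A -> U, and the
   images x_1, ..., x_n of generators of the A-module L satisfy
   x_i a - a x_i in A and x_i x_j - x_j x_i in A + A x_1 + ... + A x_n.  Hence U
   is spanned over A by words in the x_i, and two words which are permutations of
   each other differ by smaller ones.  A Hilbert basis argument on leading terms,
   with Dickson's lemma for the leading words and the ascending chain condition
   in A for the leading coefficients, shows that U is left Noetherian; the
   relations are stable under passing to the opposite ring. *)

Require Import Defs.
From mathcomp Require Import all_boot all_order all_algebra.
From mathcomp Require Import boolp classical_sets.

Set Implicit Arguments.
Unset Strict Implicit.
Unset Printing Implicit Defensive.

Import GRing.Theory.

Local Open Scope ring_scope.
Local Open Scope classical_set_scope.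

(** * Monotone subsequences of natural numbers and of tuples of them *)

Section MonotoneSubsequences.

Lemma exists_min_tail (u : nat -> nat) (m : nat) :
  exists j, (m <= j)%N /\ forall l, (m <= l)%N -> (u j <= u l)%N.
Proof.
suff H v : forall j, (m <= j)%N -> u j = v ->
    exists j, (m <= j)%N /\ forall l, (m <= l)%N -> (u j <= u l)%N.
  exact: (H (u m) m).
elim/ltn_ind: v => v IH j mj ujv.
have [//|/forallNP H] := pselect (exists l, (m <= l)%N /\ (u l < v)%N).
  by move=> [l [ml ulv]]; exact: (IH _ ulv l).
exists j; split=> // l ml; rewrite ujv leqNgt; apply/negP => ulv.
by apply: (H l).
Qed.

(** Each index is chosen to minimise [u] over the tail beyond the previous choice, so no later term
    is smaller. *)
Lemma nondecreasing_subseq (u : nat -> nat) :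
  exists s : nat -> nat, {homo s : i j / (i < j)%N} /\
    {homo u \o s : i j / (i <= j)%N}.
Proof.
have [nxt nxtP] := choice (exists_min_tail u).
pose s := fix s i := if i is i'.+1 then nxt (s i').+1 else nxt 0%N.
have sS i : (s i < s i.+1)%N by have [] := nxtP (s i).+1.
have us i l : (s i <= l)%N -> (u (s i) <= u l)%N.
  by case: i => [|i] sl; apply: (nxtP _).2; rewrite // (leq_trans _ sl) // (nxtP _).1.
exists s; split; first by apply: homo_ltn => //; exact: ltn_trans.
apply: homo_leq => // [x y z|i]; first exact: leq_trans.
by apply: us; exact: ltnW.
Qed.

(* Dickson's lemma. *)
Lemma nondecreasing_subseq_fin (I : finType) (u : nat -> I -> nat) :
  exists s : nat -> nat, {homo s : i j / (i < j)%N} /\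
    forall x, {homo (fun m => u (s m) x) : i j / (i <= j)%N}.
Proof.
(* Coordinates are treated one at a time: passing to a further subsequence keeps the monotonicity
   already obtained. *)
suff H (r : seq I) : exists s : nat -> nat, {homo s : i j / (i < j)%N} /\
    {in r, forall x, {homo (fun m => u (s m) x) : i j / (i <= j)%N}}.
  have [s [s1 s2]] := H (enum I); exists s; split=> // x.
  by apply: s2; rewrite mem_enum.
elim: r => [|y r [s [s1 s2]]]; first by exists id; split=> [|x]; rewrite ?in_nil.
have [t [t1 t2]] := nondecreasing_subseq (fun m => u (s m) y).
exists (s \o t); split=> [i j ij|x]; first by apply/s1/t1.
rewrite inE => /predU1P[-> //|xr] i j ij.
apply: (s2 x xr (t i) (t j)); move: i j ij; exact: ltnW_homo.
Qed.

End MonotoneSubsequences.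

(** * Numerical keys for words up to permutation *)

Section MonomialKeys.

Lemma exists_distinct_primes n :
  exists p : 'I_n -> nat, injective p /\ forall i, prime (p i).
Proof.
pose s := fix s i := if i is i'.+1 then sval (prime_above (s i')) else 2.
have sP i : prime (s i).
  by case: i => // i /=; case: prime_above.
have sS i : (s i < s i.+1)%N by rewrite /=; case: prime_above.
have s_mono : {homo s : i j / (i < j)%N}.
  by apply: homo_ltn => //; exact: ltn_trans.
exists s; split=> // i j sij; apply/val_inj/eqP.
by case: ltngtP => // /s_mono; rewrite sij ltnn.
Qed.

(* Prime powers lying in the same interval [M, M^2): unique factorisation
   separates the words up to permutation, while the bounds make each letter
   smaller than any word of length two. *)
Lemma exists_monomial_key n : exists q : 'I_n -> nat,
  [/\ forall i, (1 < q i)%N,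
      forall i j l, (q l < q i * q j)%N
    & forall v w, (\prod_(i <- v) q i = \prod_(i <- w) q i)%N -> perm_eq v w].
Proof.
have [p [p_inj p_prime]] := exists_distinct_primes n.
(* The shift makes [1 < M] evident, whence [1 < q i] and positive exponents. *)
pose M := (\max_i p i).+2.
have pM i : (p i <= M)%N by rewrite /M !leqW // (leq_bigmax i).
pose e i := up_log (p i) M.
have eP i : ((p i ^ (e i).-1 < M) /\ (M <= p i ^ e i))%N.
  by apply/andP; apply: up_log_bounds; rewrite // prime_gt1.
have e_gt0 i : (0 < e i)%N.
  by have [] := eP i; case: (e i).
exists (fun i => p i ^ e i)%N; split=> [i|i j l|v w].
- by apply: leq_trans (eP i).2.
- apply: (@leq_trans (M * M)); last by rewrite leq_mul ?(eP _).2.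
  rewrite -[e l]prednK // expnSr.
  have p_gt0 : (0 < p l)%N by rewrite prime_gt0.
  by apply: (@leq_trans (M * p l)); rewrite ?ltn_pmul2r ?(eP _).1 ?leq_mul2l ?pM ?orbT.
(* The valuation at [p i] counts the occurrences of [i], up to the positive factor [e i]. *)
- have lognE t i : logn (p i) (\prod_(j <- t) p j ^ e j)%N = (e i * count_mem i t)%N.
    elim: t => [|j t IH]; first by rewrite big_nil logn1 muln0.
    have pe_gt0 l : (0 < p l ^ e l)%N by rewrite expn_gt0 prime_gt0.
    rewrite big_cons lognM ?prodn_cond_gt0 //.
    rewrite IH lognX logn_prime // (inj_eq p_inj) eq_sym /= mulnDr.
    by case: eqP => [->|_]; rewrite ?muln0 // muln1.
  move=> vw; apply/allP => i _ /=; apply/eqP.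
  by have := lognE v i; rewrite vw lognE => /eqP; rewrite eqn_pmul2l // eq_sym => /eqP.
Qed.

End MonomialKeys.

(** * Left spans and the ascending chain condition *)

Section Spans.

Variables (R : pzRingType) (C G : set R).

(** Restricting the coefficients to [C] lets one notion serve for left ideals, for spans over the
    image of A, and for spans over the image of k. Elements are built term by term, so that proofs
    go by induction on the number of terms. *)
Inductive span : R -> Prop :=
| span0 : span 0
| spanMD c w p : C c -> G w -> span p -> span (c * w + p).

Lemma spanD x y : span x -> span y -> span (x + y).
Proof.
move=> sx sy; elim: sx => [|c w p Cc Gw _ IH]; first by rewrite add0r.
by rewrite -addrA; exact: spanMD.
Qed.

Lemma spanM c w : C c -> G w -> span (c * w).
Proof. by move=> Cc Gw; rewrite -[_ * _]addr0; apply: spanMD => //; exact: span0. Qed.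

Lemma span_sum (I : Type) (r : seq I) (F : I -> R) :
  (forall i, span (F i)) -> span (\sum_(i <- r) F i).
Proof. by move=> SF; elim/big_rec: _ => [|i x _]; [exact: span0|exact: spanD]. Qed.

Lemma span_map (S : pzRingType) (F : R -> S) (P : set S) :
  {morph F : x y / x + y} -> P 0 -> (forall x y, P x -> P y -> P (x + y)) ->
  (forall c w, C c -> G w -> P (F (c * w))) ->
  forall x, span x -> P (F x).
Proof.
move=> FD P0 PD PM x; elim=> [|c w p Cc Gw _ IH].
  by suff -> : F 0 = 0 by []; apply: (addrI (F 0)); rewrite -FD !addr0.
by rewrite FD; apply: PD => //; exact: PM.
Qed.

Lemma spanZ c x : (forall d, C d -> C (c * d)) -> span x -> span (c * x).
Proof.
move=> CM; elim=> [|d w p Cd Gw _ IH]; first by rewrite mulr0; exact: span0.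
by rewrite mulrDr mulrA; apply: spanMD => //; exact: CM.
Qed.

Lemma spanN x : (forall d, C d -> C (- d)) -> span x -> span (- x).
Proof.
by move=> CN sx; rewrite -mulN1r; apply: spanZ => // d Cd; rewrite mulN1r; exact: CN.
Qed.

End Spans.

Lemma span_subset (R : pzRingType) (C G G' : set R) x :
  G `<=` G' -> span C G x -> span C G' x.
Proof.
move=> GG'; elim=> [|c w p Cc Gw _ IH]; first exact: span0.
by apply: spanMD => //; exact: GG'.
Qed.

Lemma span_seqP (R : pzRingType) (s : seq R) (x : R) :
  span setT [set` s] x <->
  exists c : 'I_(size s) -> R, x = \sum_(i < size s) c i * s`_i.
Proof.
split=> [|[c ->]]; last first.
  by apply: span_sum => i; apply: spanM => //=; exact: mem_nth.
elim=> [|d w p _ /= ws _ [c ->]].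
  by exists (fun=> 0); rewrite big1 // => i _; rewrite mul0r.
have ws' : (index w s < size s)%N by rewrite index_mem.
(* If [w] is repeated in [s], its coefficient is charged to the first occurrence. *)
exists (fun i => (if i == Ordinal ws' then d else 0) + c i).
under [RHS]eq_bigr do rewrite mulrDl.
rewrite big_split /=; congr (_ + _).
rewrite (bigD1 (Ordinal ws')) //= eqxx nth_index // big1 ?addr0 //.
by move=> i /negPf ->; rewrite mul0r.
Qed.

(** The union of the increasing ideals [J m] is finitely generated, so it equals one of them, and
    that [J m] already contains [b m]. *)
Lemma left_noetherian_seq (R : comPzRingType) (b : nat -> R) :
  left_noetherian R ->
  exists m (c : 'I_m -> R), b m = \sum_(i < m) c i * b i.
Proof.
move=> Rn.
pose J m : set R := [set x | exists c : nat -> R, x = \sum_(i < m) c i * b i].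
have JS m : J m `<=` J m.+1.
  move=> _ [c ->]; exists (fun i => if (i < m)%N then c i else 0).
  rewrite big_ord_recr /= ltnn mul0r addr0.
  by apply: eq_bigr => i _; rewrite ltn_ord.
have Jle m m' : (m <= m')%N -> J m `<=` J m'.
  by move=> /subnK <-; elim: (m' - m)%N => //= d IH x /IH; exact: JS.
have JI : left_ideal [set x | exists m, J m x].
  split=> [|x y [m Jx] [m' Jy]|a x [m [c ->]]].
  - by exists 0%N, (fun=> 0); rewrite big_ord0.
  - exists (m + m')%N.
    have [c ->] := Jle _ _ (leq_addr m' m) _ Jx.
    have [d ->] := Jle _ _ (leq_addl m m') _ Jy.
    by exists (fun i => c i - d i); rewrite -sumrB; apply: eq_bigr => i _; rewrite mulrBl.
  - exists m, (fun i => a * c i); rewrite mulr_sumr.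
    by apply: eq_bigr => i _; rewrite mulrA.
have [n [g gE]] := Rn _ JI.
have gJ i : exists m, J m (g i).
  suff : [set x | exists m, J m x] (g i) by [].
  rewrite gE; exists (fun j => (j == i)%:R); rewrite (bigD1 i) //= eqxx mul1r.
  by rewrite big1 ?addr0 // => j /negPf ->; rewrite mul0r.
have [deg degP] := choice gJ.
pose m := (\max_i deg i)%N.
have : [set x | exists m, J m x] (b m).
  exists m.+1, (fun j => (j == m)%:R); rewrite big_ord_recr /= eqxx mul1r.
  by rewrite big1 ?add0r // => i _; rewrite ltn_eqF // mul0r.
rewrite gE => -[c bE].
suff : J m (b m) by move=> [d dE]; exists m, (fun i => d i).
rewrite bE; elim/big_rec: _ => [|i x _ [d ->]].
  by exists (fun=> 0); rewrite big1 // => i _; rewrite mul0r.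
have [e ->] := Jle _ _ (leq_bigmax i) _ (degP i).
exists (fun j => c i * e j + d j).
by rewrite mulr_sumr -big_split; apply: eq_bigr => j _; rewrite mulrA mulrDl.
Qed.

(** * Rings generated by coefficients and almost commuting generators *)

(** A special case of almost normalizing extensions: moving [x i] past a coefficient leaves that
    coefficient unchanged up to lower terms. The map [h] need not be injective, and [gen_ind] says
    that its image and the [x i] generate U as a ring. *)
Record almost_normalizing (A : comPzRingType) (U : pzRingType) (h : A -> U)
    (n : nat) (x : 'I_n -> U) : Prop := AlmostNormalizing {
  coefD : forall a b, h (a + b) = h a + h b;
  coefM : forall a b, h (a * b) = h a * h b;
  coef1 : h 1 = 1;
  gen_coef : forall i a, exists b, x i * h a = h a * x i + h b;
  gen_comm : forall i j, exists (c : 'I_n -> A) b,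
    x i * x j = x j * x i + (\sum_(l < n) h (c l) * x l + h b);
  gen_ind : forall S : set U, (forall a, S (h a)) -> (forall i, S (x i)) ->
    (forall u v, S u -> S v -> S (u + v)) ->
    (forall u v, S u -> S v -> S (u * v)) -> forall u, S u }.

Lemma almost_normalizing_opp (A : comPzRingType) (U : pzRingType) (h : A -> U)
    (n : nat) (x : 'I_n -> U) :
  almost_normalizing h x -> @almost_normalizing A U^c h n x.
Proof.
move=> H.
have hD := coefD H; have hM := coefM H.
have h0 : h 0 = 0 by apply: (addrI (h 0)); rewrite -hD !addr0.
have hN a : h (- a) = - h a by apply/eqP; rewrite -addr_eq0 -hD addNr h0.
have hB a b : h (a - b) = h a - h b by rewrite hD hN.
split.
- exact: hD.
- by move=> a b; rewrite mulrC hM.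
- exact: coef1 H.
- move=> i a; have [b e] := gen_coef H i a; exists (- b).
  by apply: (addIr (h b)); rewrite hN subrK; exact: esym.
- move=> i j; have [c [b e]] := gen_comm H i j.
  (* Coefficients change sides in the opposite ring; [h (d l)] is the difference between
     [x l * h (c l)] and [h (c l) * x l], and enters the constant term. *)
  have [d dP] := choice (fun l => gen_coef H l (c l)).
  exists (fun l => - c l), (\sum_(l < n) d l - b).
  change (x j * x i = x i * x j +
    (\sum_(l < n) x l * h (- c l) + h (\sum_(l < n) d l - b)) :> U).
  rewrite e -addrA -[LHS]addr0 hB (big_morph h hD h0); congr (_ + _).
  rewrite addrACA [h b + _]addrCA subrr addr0 -!big_split big1 // => l _ /=.
  by rewrite hN mulrN dP opprD addrA subrr add0r addNr.
- by move=> S Sh Sx SD SM; apply: (gen_ind H) => // u v Su Sv; exact: SM.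
Qed.

(** * Leading terms and the Hilbert basis argument *)

Section LeftNoetherian.

Variables (A : comPzRingType) (U : pzRingType) (h : A -> U).
Variables (n : nat) (x : 'I_n -> U) (hx : almost_normalizing h x).
Variables (q : 'I_n -> nat) (q_gt1 : forall i, (1 < q i)%N).
Variables (q_lt : forall i j l, (q l < q i * q j)%N).
Variables (q_inj : forall v w,
  (\prod_(i <- v) q i = \prod_(i <- w) q i)%N -> perm_eq v w).

Let hD := coefD hx.
Let hM := coefM hx.
Let h1 := coef1 hx.

Let h0 : h 0 = 0.
Proof. by apply: (addrI (h 0)); rewrite -hD !addr0. Qed.

Let hN a : h (- a) = - h a.
Proof. by apply/eqP; rewrite -addr_eq0 -hD addNr h0. Qed.

Definition mon (w : seq 'I_n) : U := \prod_(i <- w) x i.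
(* The graded lexicographic order is replaced by the natural order on these
   numbers. *)
Definition key (w : seq 'I_n) : nat := (\prod_(i <- w) q i)%N.
(** The bound is strict, so that [low 0] is zero and [low (key w)] consists of the terms of lower
    order than [w]. *)
Definition low (N : nat) : set U :=
  span (range h) [set mon w | w in [set w | (key w < N)%N]].

Lemma mon_cons i w : mon (i :: w) = x i * mon w.
Proof. exact: big_cons. Qed.

Lemma key_cons i w : key (i :: w) = (q i * key w)%N.
Proof. exact: big_cons. Qed.

Lemma mon_cat v w : mon (v ++ w) = mon v * mon w.
Proof. exact: big_cat. Qed.

Lemma key_cat v w : key (v ++ w) = (key v * key w)%N.
Proof. exact: big_cat. Qed.

Lemma key_gt0 w : (0 < key w)%N.
Proof. by apply: prodn_gt0 => i; exact: ltnW. Qed.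

Lemma key_perm v w : perm_eq v w -> key v = key w.
Proof. exact: perm_big. Qed.

Lemma low0 N : low N 0. Proof. exact: span0. Qed.

Lemma lowD N u v : low N u -> low N v -> low N (u + v).
Proof. exact: spanD. Qed.

Lemma low_mon N a w : (key w < N)%N -> low N (h a * mon w).
Proof. by move=> wN; apply: spanM; [exists a|exists w]. Qed.

Lemma low_mon1 N w : (key w < N)%N -> low N (mon w).
Proof. by move=> wN; rewrite -[mon w]mul1r -h1; exact: low_mon. Qed.

Lemma lowN N u : low N u -> low N (- u).
Proof. by apply: spanN => _ [a _ <-]; exists (- a). Qed.

Lemma lowB N u v : low N u -> low N v -> low N (u - v).
Proof. by move=> lu lv; apply: lowD => //; exact: lowN. Qed.

Lemma lowZ N a u : low N u -> low N (h a * u).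
Proof. by apply: spanZ => _ [b _ <-]; exists (a * b). Qed.

Lemma low_le N M u : (N <= M)%N -> low N u -> low M u.
Proof.
move=> NM; apply: span_subset => _ [w wN <-]; exists w => //=.
exact: leq_trans wN NM.
Qed.

Lemma low0_eq u : low 0 u -> u = 0.
Proof. by elim=> // c w p _ []. Qed.

Lemma low_map N (F : U -> U) (P : set U) :
  {morph F : u v / u + v} -> P 0 -> (forall u v, P u -> P v -> P (u + v)) ->
  (forall a w, (key w < N)%N -> P (F (h a * mon w))) ->
  forall u, low N u -> P (F u).
Proof.
by move=> FD P0 PD PM; apply: span_map => // _ _ [a _ <-] [w wN <-]; exact: PM.
Qed.

(** Moving [x i] past a coefficient only adds a coefficient times the old word, whose key is no
    larger. *)
Lemma low_genM i N u : low N u -> low (q i * N) (x i * u).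
Proof.
apply: (@low_map _ ( *%R (x i))); first by move=> y z; rewrite mulrDr.
- exact: low0.
- by move=> *; exact: lowD.
move=> a w wN; have [b e] := gen_coef hx i a.
rewrite mulrA e mulrDl -mulrA -mon_cons; apply: lowD; apply: low_mon.
  by rewrite key_cons ltn_pmul2l // ltnW.
by rewrite (leq_trans wN) // leq_pmull // ltnW.
Qed.

Lemma low_monM v N u : low N u -> low (key v * N) (mon v * u).
Proof.
move=> lu; elim: v => [|i v IH]; first by rewrite /mon /key !big_nil mul1n mul1r.
by rewrite mon_cons key_cons -mulnA -mulrA; exact: low_genM.
Qed.

Lemma lowM_mon v N u : low N u -> low (N * key v) (u * mon v).
Proof.
apply: (@low_map _ ( *%R^~ (mon v))); first by move=> y z; rewrite mulrDl.
- exact: low0.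
- by move=> *; exact: lowD.
move=> a w wN; rewrite -mulrA -mon_cat; apply: low_mon.
by rewrite key_cat ltn_pmul2r ?key_gt0.
Qed.

(** Leibniz rule in the first letter: the extra term [h b * mon v] has lost that letter, and every
    letter has key above 1. *)
Lemma mon_coefC v a : low (key v) (mon v * h a - h a * mon v).
Proof.
elim: v => [|i v IH]; first by rewrite /mon big_nil mul1r mulr1 subrr; exact: low0.
have [b e] := gen_coef hx i a.
have -> : mon (i :: v) * h a - h a * mon (i :: v) =
    x i * (mon v * h a - h a * mon v) + h b * mon v.
  by rewrite mon_cons mulrBr !mulrA e mulrDl opprD addrA addrNK.
apply: lowD; first by rewrite key_cons; exact: low_genM.
by apply: low_mon; rewrite key_cons ltn_Pmull // key_gt0.
Qed.

(** The commutator of two letters is a combination of single letters and a constant; [q_lt] makes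
    any single letter smaller than the pair it replaces. *)
Lemma mon_genC v i : low (q i * key v) (mon v * x i - x i * mon v).
Proof.
elim: v => [|j v IH]; first by rewrite /mon big_nil mul1r mulr1 subrr; exact: low0.
have [c [b e]] := gen_comm hx j i.
have -> : mon (j :: v) * x i - x i * mon (j :: v) =
    x j * (mon v * x i - x i * mon v) +
    (\sum_(l < n) h (c l) * x l + h b) * mon v.
  rewrite mon_cons mulrBr !mulrA e [X in _ - X + _]mulrDl opprD addrA.
  by rewrite addrNK.
rewrite key_cons; apply: lowD; first by rewrite mulnCA; exact: low_genM.
rewrite mulrDl mulr_suml; apply: lowD; first last.
  by apply: low_mon; rewrite mulnA ltn_Pmull ?key_gt0 // (ltn_trans (q_gt1 i)).
apply: span_sum => l; rewrite -mulrA -mon_cons; apply: low_mon.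
by rewrite key_cons mulnA ltn_pmul2r ?key_gt0.
Qed.

(** The first letter of [w] is brought to the front of [v] modulo lower terms, and the remaining
    letters are handled by induction. *)
Lemma mon_perm v w : perm_eq v w -> low (key w) (mon v - mon w).
Proof.
elim: w v => [|i w IH] v pvw.
  by rewrite (perm_nilP pvw) subrr; exact: low0.
have iv : i \in v by rewrite (perm_mem pvw) mem_head.
move: pvw; case/splitPr: iv => v1 v2 pvw.
have {}pvw : perm_eq (v1 ++ v2) w by rewrite -(perm_cons i) -(perm_catCA v1 [:: i] v2).
have -> : mon (v1 ++ i :: v2) - mon (i :: w) =
    (mon v1 * x i - x i * mon v1) * mon v2 + x i * (mon (v1 ++ v2) - mon w).
  by rewrite !mon_cat !mon_cons mulrBl mulrBr !mulrA addrA addrNK.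
apply: lowD; last by rewrite key_cons; apply: low_genM; exact: IH.
rewrite key_cons -(key_perm pvw) key_cat mulnA.
by apply: lowM_mon; exact: mon_genC.
Qed.

(** The union of all [low N] contains the generators of U and is closed under sums and products. *)
Lemma low_total u : exists N, low N u.
Proof.
have up N M v : low N v -> low (N + M) v by apply: low_le; rewrite leq_addr.
apply: (gen_ind hx (S := [set u | exists N, low N u])) => /=.
- move=> a; exists 2; rewrite -[h a]mulr1.
  have := @low_mon 2 a [::]; rewrite /mon /key !big_nil; exact.
- move=> i; exists (q i).+1; have := @low_mon1 (q i).+1 [:: i].
  by rewrite /mon /key !big_seq1; exact.
- move=> u1 v [N lu] [M lv]; exists (N + M)%N; apply: lowD; first exact: up.
  by rewrite addnC; exact: up.
move=> u1 v [N lu] [M lv].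
pose P u := exists N, low N u.
apply: (@low_map _ ( *%R^~ v) P _ _ _ _ _ lu); first by move=> y z; rewrite mulrDl.
- by exists 0%N; exact: low0.
- move=> y z [K ly] [K' lz]; exists (K + K')%N; apply: lowD; first exact: up.
  by rewrite addnC; exact: up.
move=> a w _; exists (key w * M)%N.
by rewrite -mulrA; apply: lowZ; exact: low_monM.
Qed.

(** By [q_inj] all words of key N are permutations of one another, hence agree modulo lower terms,
    and their coefficients add up to a single leading one. *)
Lemma low_lead N u : low N.+1 u -> low N u \/
  exists a w, key w = N /\ low N (u - h a * mon w).
Proof.
elim=> [|_ _ p [a _ <-] [w /= wN <-] _ IH]; first by left; exact: low0.
move: wN; rewrite ltnS leq_eqVlt => /orP[/eqP wN|wN].
  right; case: IH => [lp|[b [v [vN lp]]]].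
    by exists a, w; rewrite addrC addKr.
  exists (a + b), w; split=> //.
  have -> : h a * mon w + p - h (a + b) * mon w =
      (p - h b * mon v) + h b * (mon v - mon w).
    by rewrite hD mulrDl opprD addrACA subrr add0r mulrBr addrA addrNK.
  by apply: lowD => //; apply: lowZ; rewrite -wN; apply/mon_perm/q_inj; rewrite -!/(key _) vN.
case: IH => [lp|[b [v [vN lp]]]]; [left|right].
  by apply: lowD => //; exact: low_mon.
by exists b, v; rewrite -addrA; split=> //; apply: lowD => //; exact: low_mon.
Qed.

(** Since words commute with coefficients modulo lower terms, left multiplication by a word keeps
    the leading coefficient. *)
Lemma lead_monM v w w' a u : perm_eq (v ++ w') w ->
  low (key w') (u - h a * mon w') -> low (key w) (mon v * u - h a * mon w).
Proof.
move=> pw lu.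
have -> : mon v * u - h a * mon w = mon v * (u - h a * mon w') +
    ((mon v * h a - h a * mon v) * mon w' + h a * (mon (v ++ w') - mon w)).
  by rewrite !mulrBr mulrBl mon_cat !mulrA addrA !subrKA.
have kw : key w = (key v * key w')%N by rewrite -key_cat; apply/esym/key_perm.
apply: lowD; first by rewrite kw; exact: low_monM.
apply: lowD; first by rewrite kw; apply: lowM_mon; exact: mon_coefC.
by apply: lowZ; exact: mon_perm.
Qed.

(* A left ideal I that is not finitely generated contains a sequence p_m, each
   term of minimal key outside the left ideal generated by the previous ones.
   Along a subsequence whose leading words increase, some leading coefficient
   is a combination of the earlier ones, so that p_m can be reduced to a
   smaller key, a contradiction. *)
Lemma almost_normalizing_left_noetherian : left_noetherian A -> left_noetherian U.
Proof.
move=> An I [I0 IB IM].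
have ID u v : I u -> I v -> I (u + v).
  by move=> Iu Iv; rewrite -[v]opprK -[- v]sub0r; apply: (IB) => //; apply: (IB).
pose gen (s : seq U) : set U := span setT [set` s].
have genI (s : seq U) : [set` s] `<=` I -> gen s `<=` I.
  by move=> sI u; elim=> // c w p _ ws _ Ip; apply: ID => //; apply/IM/sI.
have [[s [sI Is]]|nfg] := pselect (exists s : seq U, [set` s] `<=` I /\ I `<=` gen s).
  exists (size s), (fun i => s`_i); apply/seteqP; split=> [u /Is /span_seqP //|u].
  by move=> /span_seqP; exact: genI.
(* [d] holds an element, its leading word and its leading coefficient; a dummy value makes the
   choice total when [s] is not inside I. *)
have step (s : seq U) : exists d : U * seq 'I_n * A, [set` s] `<=` I ->
    [/\ I d.1.1, ~ gen s d.1.1, low (key d.1.2) (d.1.1 - h d.2 * mon d.1.2)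
      & forall p, I p -> low (key d.1.2) p -> gen s p].
  have [sI|] := pselect ([set` s] `<=` I); last by exists (0, [::], 0).
  have [p0 [Ip0 gp0]] : exists p, I p /\ ~ gen s p.
    apply: contrapT => /forallNP H; apply: nfg; exists s; split=> // p Ip.
    by apply: contrapT => gp; apply: (H p).
  have [N0 lp0] := low_total p0.
  (* Minimality is reached by descent on the bound: any smaller element of I outside [gen s] takes
     over the role of [p]. *)
  elim/ltn_ind: N0 p0 Ip0 gp0 lp0 => -[|N] IH p Ip gp lp.
    by case: gp; rewrite (low0_eq lp); exact: span0.
  have [lpN|[a [w [wN lw]]]] := low_lead lp; first exact: IH lpN.
  have [[p' [Ip' gp' lp']]|H] := pselect (exists p', [/\ I p', ~ gen s p' & low N p']).
    exact: IH lp'.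
  exists (p, w, a) => _ /=; split=> // [|p' Ip' lp']; first by rewrite wN.
  by apply: contrapT => gp'; apply: H; exists p'; rewrite -wN.
have [nxt nxtP] := choice step.
pose s := fix s m := if m is m'.+1 then rcons (s m') (nxt (s m')).1.1 else [::].
pose p m := (nxt (s m)).1.1; pose w m := (nxt (s m)).1.2; pose a m := (nxt (s m)).2.
have sI m : [set` s m] `<=` I.
  elim: m => [|m IH] u //=; rewrite mem_rcons inE => /predU1P[->|/IH //].
  by have [] := nxtP _ IH.
have ps i j : (i < j)%N -> p i \in s j.
  elim: j => // j IH; rewrite ltnS leq_eqVlt /= mem_rcons inE => /predU1P[->|/IH ->].
    by rewrite eqxx.
  by rewrite orbT.
have pP m := nxtP _ (sI m).
have [t [t_lt t_mono]] := nondecreasing_subseq_fin (fun m i => count_mem i (w m)).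
have [m [c cE]] := left_noetherian_seq (a \o t) An.
(* Smaller letter counts mean that [w (t j)] divides [w (t m)] up to permutation; [v] is the
   cofactor. *)
have vP (j : 'I_m) : exists v, perm_eq (v ++ w (t j)) (w (t m)).
  have /count_subseqP[r /perm_to_subseq [v vE] rE] :
      forall i, (count_mem i (w (t j)) <= count_mem i (w (t m)))%N.
    by move=> i; apply: t_mono; exact: ltnW.
  exists v; rewrite perm_sym (perm_trans vE) // perm_catC perm_cat2l perm_sym.
  by [].
have [v vE] := choice vP.
have [Ip ngp lp minp] := pP (t m).
(* Each earlier element is multiplied up to the leading word of [p (t m)]; the coefficients [c] then
   match the leading coefficients. *)
pose r := \sum_(j < m) h (c j) * (mon (v j) * p (t j)).
have gr : gen (s (t m)) r.
  apply: span_sum => j; rewrite mulrA; apply: spanM => //=.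
  by apply/ps/t_lt.
(* The leading terms of [p (t m)] and [r] cancel, so the difference is generated by minimality, and
   [r] is generated by construction. *)
case: ngp; rewrite -[X in gen _ X](subrK r); apply: spanD => //.
apply: minp; first by apply: IB => //; apply: genI gr; exact: sI.
have -> : (nxt (s (t m))).1.1 - r =
    (p (t m) - h (a (t m)) * mon (w (t m))) -
    \sum_(j < m) h (c j) * (mon (v j) * p (t j) - h (a (t j)) * mon (w (t m))).
  under [in RHS]eq_bigr do rewrite mulrBr mulrA.
  rewrite sumrB opprB addrA -/(p _).
  have -> : h (a (t m)) * mon (w (t m)) =
      \sum_(j < m) h (c j) * (h (a (t j)) * mon (w (t m))).
    rewrite -[a (t m)]/((a \o t) m) cE (big_morph h hD h0) mulr_suml.
    by apply: eq_bigr => j _; rewrite hM mulrA.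
  by rewrite addrNK; congr (_ - _); apply: eq_bigr => j _; rewrite mulrA.
apply: lowB => //; apply: span_sum => j; apply: lowZ; apply: lead_monM (vE j) _.
by have [] := pP (t j).
Qed.

End LeftNoetherian.

Lemma almost_normalizing_noetherian (A : comPzRingType) (U : pzRingType)
    (h : A -> U) (n : nat) (x : 'I_n -> U) :
  almost_normalizing h x -> left_noetherian A -> noetherian U.
Proof.
move=> hx An; have [q [q1 q2 q3]] := exists_monomial_key n.
split; first exact: (almost_normalizing_left_noetherian hx q1 q2 q3).
exact: (almost_normalizing_left_noetherian (almost_normalizing_opp hx) q1 q2 q3).
Qed.

(** * The word-length filtration on quotients of a tensor algebra *)

Lemma tensor_ind (k : comPzRingType) (M : lmodType k) (S : set (tensor_algebra M)) :
  (forall c, S (tensor_scal M c)) -> (forall u, S (tensor_gen u)) ->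
  (forall x y, S x -> S y -> S (x + y)) -> (forall x y, S x -> S y -> S (x * y)) ->
  forall x, S x.
Proof.
move=> Ss Sg SD SM x; have [s <-] := tensor_class_surj x.
elim: s => [c|u|s Hs t Ht|s Hs t Ht]; [exact: Ss|exact: Sg| |].
  by rewrite tensor_classD; exact: SD.
by rewrite tensor_classM; exact: SM.
Qed.

Section AlmostCommutative.

Variables (k : comPzRingType) (M : lmodType k) (U : pzRingType).
Variables (P : {rmorphism tensor_algebra M -> U}) (P_surj : forall u, exists x, P x = u).
Variables (br : M -> M -> M) (brE : forall u v,
  P (tensor_gen u) * P (tensor_gen v) =
  P (tensor_gen v) * P (tensor_gen u) + P (tensor_gen (br u v))).

Let s c := P (tensor_scal M c).
Let g u := P (tensor_gen u).

Definition word (w : seq M) : U := \prod_(u <- w) g u.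
Definition filt (i : nat) : set U :=
  span (range s) [set word w | w in [set w | (size w <= i)%N]].

Lemma image_tensor_filt i : P @` @tensor_filt k M i = filt i.
Proof.
apply/seteqP; split=> [_ [_ [m [c [w [wi ->]]]] <-]|u].
  rewrite rmorph_sum; apply: span_sum => l; rewrite rmorphM rmorph_prod.
  by apply: spanM; [exists (c l)|exists (w l) => //; exact: wi].
elim=> [|_ _ p [c _ <-] [w /= wi <-] _ [_ [m [d [v [vi ->]]]] <-]].
  exists 0; last by rewrite rmorph0.
  by exists 0%N, (fun=> 0), (fun=> [::]); split=> //; rewrite big_ord0.
(* [unlift ord0] fails exactly at the new index, where the defaults [c] and [w] supply the extra
   summand. *)
exists (\sum_(l < m.+1) tensor_scal M (oapp d c (unlift ord0 l)) *
    \prod_(u <- oapp v w (unlift ord0 l)) tensor_gen u).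
  exists m.+1, (fun l => oapp d c (unlift ord0 l)), (fun l => oapp v w (unlift ord0 l)).
  by split=> // l; case: unliftP => [l1 _|_] /=.
rewrite big_ord_recl unlift_none rmorphD rmorphM rmorph_prod; congr (_ + P _).
by apply: eq_bigr => l _; rewrite liftK.
Qed.

Lemma scal_comm c u : s c * u = u * s c.
Proof. by have [x <-] := P_surj u; rewrite -!rmorphM tensor_scalC. Qed.

Lemma word_cons u w : word (u :: w) = g u * word w.
Proof. exact: big_cons. Qed.

Lemma word_cat v w : word (v ++ w) = word v * word w.
Proof. exact: big_cat. Qed.

Lemma filt_scalM i c w : (size w <= i)%N -> filt i (s c * word w).
Proof. by move=> wi; apply: spanM; [exists c|exists w]. Qed.

Lemma filt_word i w : (size w <= i)%N -> filt i (word w).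
Proof. by rewrite -[word w]mul1r -(rmorph1 P); exact: filt_scalM. Qed.

Lemma filt_gen u : filt 1 (g u).
Proof. by have := @filt_word 1 [:: u]; rewrite /word big_seq1; exact. Qed.

Lemma filtZ i c u : filt i u -> filt i (s c * u).
Proof. by apply: spanZ => _ [d _ <-]; exists (c * d) => //; rewrite /s !rmorphM. Qed.

Lemma filt_opp i u : filt i u -> filt i (- u).
Proof. by apply: spanN => _ [d _ <-]; exists (- d) => //; rewrite /s !rmorphN. Qed.

Lemma filt_le i j u : (i <= j)%N -> filt i u -> filt j u.
Proof.
by move=> ij; apply: span_subset => _ [w /= wi <-]; exists w => //=; exact: leq_trans ij.
Qed.

Lemma filt_map i (F : U -> U) (S : set U) :
  {morph F : u v / u + v} -> S 0 -> (forall u v, S u -> S v -> S (u + v)) ->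
  (forall c w, (size w <= i)%N -> S (F (s c * word w))) ->
  forall u, filt i u -> S (F u).
Proof.
by move=> FD S0 SD SM; apply: span_map => // _ _ [a _ <-] [w wN <-]; exact: SM.
Qed.

Lemma filt_mul i j u v : filt i u -> filt j v -> filt (i + j) (u * v).
Proof.
move=> fu fv; apply: (@filt_map i ( *%R^~ v) _ _ _ _ _ _ fu).
- by move=> y z; rewrite mulrDl.
- exact: span0.
- by move=> y z; exact: spanD.
move=> c w wi; rewrite -mulrA; apply: filtZ.
apply: (@filt_map j ( *%R (word w)) _ _ _ _ _ _ fv).
- by move=> y z; rewrite mulrDr.
- exact: span0.
- by move=> y z; exact: spanD.
move=> d w' wj; rewrite mulrA -scal_comm -mulrA -word_cat.
by apply: filt_scalM; rewrite size_cat leq_add.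
Qed.

(** Each exchange replaces two letters by the single letter [br u v], which lowers the length by
    one. *)
Lemma gen_wordC u w : filt (size w) (g u * word w - word w * g u).
Proof.
elim: w => [|v w IH]; first by rewrite /word big_nil mulr1 mul1r subrr; exact: span0.
have -> : g u * word (v :: w) - word (v :: w) * g u =
    word (br u v :: w) + g v * (g u * word w - word w * g u).
  by rewrite !word_cons mulrBr !mulrA brE mulrDl addrAC addrC.
apply: spanD; first exact: filt_word.
by apply: (@filt_mul 1) => //; exact: filt_gen.
Qed.

(** Leibniz rule in the first letter of the left word, with [gen_wordC] for the commutators of
    single letters. *)
Lemma word_wordC m v w : (size v + size w <= m.+1)%N ->
  filt m (word v * word w - word w * word v).
Proof.
elim: v m => [|u v IH] m /= vwm.
  by rewrite {1 4}/word big_nil mulr1 mul1r subrr; exact: span0.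
rewrite addSn ltnS in vwm.
have -> : word (u :: v) * word w - word w * word (u :: v) =
    g u * (word v * word w - word w * word v) +
    (g u * word w - word w * g u) * word v.
  by rewrite word_cons mulrBr mulrBl !mulrA subrKA.
apply: spanD; last first.
  rewrite addnC in vwm; apply: filt_le vwm _; apply: filt_mul; first exact: gen_wordC.
  exact: filt_word.
(* For [m = 0] there is no smaller bound to induct on, but both remaining words are then empty. *)
case: m vwm => [|m] vwm; last first.
  by apply: (@filt_mul 1); [exact: filt_gen|exact: IH].
move: vwm; rewrite leqn0 addn_eq0 => /andP[/nilP -> /nilP ->].
by rewrite subrr mulr0; exact: span0.
Qed.

(** The commutator is biadditive and scalars are central, so words suffice. *)
Lemma filt_commutator i j m u v : filt i u -> filt j v ->
  (forall w w', (size w <= i)%N -> (size w' <= j)%N ->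
     filt m (word w * word w' - word w' * word w)) ->
  filt m (u * v - v * u).
Proof.
move=> fu fv H; apply: (@filt_map i (fun y => y * v - v * y) _ _ _ _ _ _ fu).
- by move=> y z; rewrite mulrDl mulrDr opprD addrACA.
- exact: span0.
- by move=> y z; exact: spanD.
move=> c w wi.
have -> : s c * word w * v - v * (s c * word w) = s c * (word w * v - v * word w).
  by rewrite mulrBr !mulrA -[v * _]scal_comm.
apply: filtZ; apply: (@filt_map j (fun y => word w * y - y * word w) _ _ _ _ _ _ fv).
- by move=> y z; rewrite mulrDl mulrDr opprD addrACA.
- exact: span0.
- by move=> y z; exact: spanD.
move=> d w' wj.
have -> : word w * (s d * word w') - s d * word w' * word w =
    s d * (word w * word w' - word w' * word w).
  by rewrite mulrBr !mulrA [s d * word w]scal_comm.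
by apply: filtZ; exact: H.
Qed.

Lemma almost_commutative_filt : almost_commutative filt.
Proof.
split.
- by move=> i; exact: span0.
- by move=> i u v fu fv; apply: spanD => //; exact: filt_opp.
- by have := @filt_word 0 [::]; rewrite /word big_nil; exact.
- by move=> i u; exact: filt_le.
- move=> u; have [x <-] := P_surj u.
  apply: (tensor_ind (S := [set x | exists i, filt i (P x)])) => /=.
  + by move=> c; exists 0%N; have := @filt_scalM 0 c [::]; rewrite /word big_nil mulr1; exact.
  + by move=> v; exists 1%N; exact: filt_gen.
  + move=> y z [i fy] [j fz]; exists (i + j)%N; rewrite rmorphD; apply: spanD.
      by apply: filt_le fy; exact: leq_addr.
    by apply: filt_le fz; exact: leq_addl.
  + by move=> y z [i fy] [j fz]; exists (i + j)%N; rewrite rmorphM; exact: filt_mul.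
- by move=> i j u v; exact: filt_mul.
move=> i j u v fu fv; case ij: (i + j)%N => [|m]; last first.
  apply: (filt_commutator fu fv) => w w' wi wj; apply: word_wordC.
  by rewrite -ij leq_add.
move/eqP: ij; rewrite addn_eq0 => /andP[/eqP i0 /eqP j0]; rewrite {}i0 {}j0 in fu fv.
(* In degree zero only the empty word occurs, so elements are scalars and hence central. *)
suff [c ->] : exists c, u = s c by rewrite /= scal_comm subrr.
elim: fu => [|_ _ p [c _ <-] [w /= + <-] _ [d ->]].
  by exists 0; rewrite /s !rmorph0.
rewrite leqn0 => /nilP ->; exists (c + d).
by rewrite /word big_nil mulr1 /s !rmorphD.
Qed.

End AlmostCommutative.

(** * Relations shared by both enveloping rings *)

Section EnvelopingRings.

Variables (k A : comPzRingType) (phi : {rmorphism k -> A}).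
Variables (f : Der phi -> Der phi -> A) (L : DLie f).

(* Given the second family of relations, the third families of J1 and J2 are
   both equivalent to [env_coef]. *)
Record enveloping (U : pzRingType) (P : TL L -> U) : Prop := Enveloping {
  env_D : P (TL_gen (dl_D L)) = 1;
  env_scale : forall a u,
    P (TL_gen (a *: u)) = P (TL_gen (a *: dl_D L)) * P (TL_gen u);
  env_coef : forall v b, P (TL_gen v) * P (TL_gen (b *: dl_D L)) =
    P (TL_gen (b *: dl_D L)) * P (TL_gen v) + P (TL_gen (dl_pi L v b *: dl_D L));
  env_lie : forall u v, P (TL_gen u) * P (TL_gen v) =
    P (TL_gen v) * P (TL_gen u) + P (TL_gen (dl_bracket u v)) }.

Lemma TL_genD (u v : L) : TL_gen (u + v) = TL_gen u + TL_gen v.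
Proof. exact: tensor_genD. Qed.

Lemma TL_gen0 : TL_gen (0 : L) = 0.
Proof. by apply: (addrI (TL_gen (0 : L))); rewrite -TL_genD !addr0. Qed.

Lemma enveloping_almost_commutative (U : pzRingType) (P : {rmorphism TL L -> U}) :
  (forall u, exists x, P x = u) -> enveloping P ->
  almost_commutative (fun i => P @` @TL_filt k A phi f L i).
Proof.
move=> P_surj HP.
have -> : (fun i => P @` @TL_filt k A phi f L i) = filt P.
  by apply/funext => i; exact: image_tensor_filt.
by apply: (almost_commutative_filt P_surj (br := @dl_bracket _ _ _ _ L)); exact: env_lie HP.
Qed.

Lemma enveloping_noetherian (U : pzRingType) (P : {rmorphism TL L -> U}) :
  (forall u, exists x, P x = u) -> enveloping P ->
  left_noetherian A -> @finitely_generated A L -> noetherian U.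
Proof.
move=> P_surj HP An [n [e eP]].
pose h (a : A) := P (TL_gen (a *: dl_D L)); pose x i := P (TL_gen (e i)).
have gE (u : L) : exists c, P (TL_gen u) = \sum_(i < n) h (c i) * x i.
  have [c ->] := eP u; exists c.
  rewrite (@big_morph _ _ (fun u : L => P (TL_gen u)) 0 +%R 0 +%R) //.
    by apply: eq_bigr => i _; rewrite (env_scale HP).
    by move=> v w; rewrite TL_genD rmorphD.
  by rewrite TL_gen0 rmorph0.
have h0 : h 0 = 0 by rewrite /h scale0r TL_gen0 rmorph0.
apply: (almost_normalizing_noetherian (h := h) (x := x)) An; split.
- by move=> a b; rewrite /h scalerDl TL_genD rmorphD.
- by move=> a b; rewrite /h -scalerA (env_scale HP).
- by rewrite /h scale1r (env_D HP).
- by move=> i a; exists (dl_pi L (e i) a); exact: (env_coef HP).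
- move=> i j; have [c cE] := gE (dl_bracket (e i) (e j)).
  (* The bracket lies in L, hence in the A-span of the generators, so the constant term is zero. *)
  exists c, 0; rewrite -cE h0 addr0; exact: (env_lie HP).
- move=> S Sh Sx SD SM u; have [y <-] := P_surj u.
  have S0 : S 0 by rewrite -h0.
  apply: (@tensor_ind k (restr_scalars L phi) [set y | S (P y)]) => /= [c|v|y1 y2|y1 y2].
  (* As D maps to 1, the scalar [c] has the same image as [phi c *: D]. *)
  + suff -> : P (tensor_scal _ c) = h (phi c) by [].
    rewrite -[LHS]mulr1 -(env_D HP) -rmorphM; congr (P _); apply: esym.
    exact: (@tensor_genZ k (restr_scalars L phi)).
  + have [c ->] := gE v; elim/big_rec: _ => // i z _ Sz.
    by apply: (SD) => //; apply: SM.
  + by rewrite rmorphD; exact: SD.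
  + by rewrite rmorphM; exact: SM.
Qed.

(** The identity [dl_ractE] expands the right action in the third family of relations, which turns
    it into [env_coef]. *)
Lemma enveloping_J1 (U : pzRingType) (P : {rmorphism TL L -> U}) :
  (forall t, J1_gens t -> P t = 0) -> (forall t, Lie_gens t -> P t = 0) ->
  enveloping P.
Proof.
move=> PJ PL; have Psub s t : P (s - t) = 0 -> P s = P t.
  by rewrite rmorphB => /eqP; rewrite subr_eq0 => /eqP.
have Pscale a u : P (TL_gen (a *: u)) = P (TL_gen (a *: dl_D L)) * P (TL_gen u).
  by rewrite -rmorphM; apply/Psub/PJ; left; right; exists a, u.
split=> //.
- by rewrite -(rmorph1 P); apply/Psub/PJ; left; left.
- move=> v b; have /Psub : P (TL_gen (dl_ract v b) - TL_gen v * TL_gen (b *: dl_D L)) = 0.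
    by apply: PJ; right; exists b, v.
  by rewrite rmorphM => <-; rewrite dl_ractE TL_genD rmorphD (Pscale b v).
- move=> u v; rewrite -!rmorphM -rmorphD; apply/Psub.
  by rewrite opprD addrA; apply: PL; exists u, v.
Qed.

Lemma enveloping_J2 (U : pzRingType) (P : {rmorphism TL L -> U}) :
  (forall t, J2_gens t -> P t = 0) -> (forall t, Lie_gens t -> P t = 0) ->
  enveloping P.
Proof.
move=> PJ PL; have Psub s t : P (s - t) = 0 -> P s = P t.
  by rewrite rmorphB => /eqP; rewrite subr_eq0 => /eqP.
split.
- by rewrite -(rmorph1 P); apply/Psub/PJ; left; left.
- by move=> a u; rewrite -rmorphM; apply/Psub/PJ; left; right; exists a, u.
- move=> v b; rewrite -!rmorphM -rmorphD; apply/Psub.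
  by rewrite opprD addrA; apply: PJ; right; exists b, v.
- move=> u v; rewrite -!rmorphM -rmorphD; apply/Psub.
  by rewrite opprD addrA; apply: PL; exists u, v.
Qed.

End EnvelopingRings.

(** * Application to the iterated quotients *)

Lemma quot_proj_gen (R : pzRingType) (S : set R) y : S y -> quot_proj S y = 0.
Proof.
move=> Sy; rewrite -[0](rmorph0 (@quot_proj R S)); apply/quot_projP.
by rewrite subr0 => I [_]; exact.
Qed.

Lemma comp_proj_surj (R : pzRingType) (S : set R) (S' : set (quot_ring S)) u :
  exists y, quot_proj S' (quot_proj S y) = u.
Proof.
by have [y <-] := quot_proj_surj u; have [z <-] := quot_proj_surj y; exists z.
Qed.

Theorem theorem1p2 (k A : comPzRingType) (phi : {rmorphism k -> A})
    (f : Der phi -> Der phi -> A) (f_cocycle : cocycle2 f) (L : DLie f)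
    (A_noetherian : noetherian A) (L_fg : @finitely_generated A L) :
  (almost_commutative (@tUten_filt k A phi f L) /\ noetherian (tUten L)) /\
  (almost_commutative (@tUrho_filt k A phi f L) /\ noetherian (tUrho L)).
Proof.
split.
(* The two quotient maps are composed into one surjection from the tensor algebra, which carries
   [TL_filt] onto the given filtration. *)
- pose P : {rmorphism TL L -> tUten L} :=
    (@quot_proj (Uten L) (@Uten_proj _ _ _ _ L @` @Lie_gens _ _ _ _ L)
      \o @quot_proj (TL L) (@J1_gens _ _ _ _ L))%FUN.
  have P_surj u : exists t, P t = u by exact: comp_proj_surj.
  have PE : enveloping P.
    apply: enveloping_J1 => t Jt; rewrite /P /=.
      by rewrite (quot_proj_gen Jt) rmorph0.
    by apply: quot_proj_gen; exists t.
  split; last exact: enveloping_noetherian P_surj PE A_noetherian.1 L_fg.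
  have -> : @tUten_filt k A phi f L = fun i => P @` @TL_filt k A phi f L i.
    by apply/funext => i; rewrite /tUten_filt image_comp.
  exact: enveloping_almost_commutative.
- pose P : {rmorphism TL L -> tUrho L} :=
    (@quot_proj (Urho L) (@Urho_proj _ _ _ _ L @` @Lie_gens _ _ _ _ L)
      \o @quot_proj (TL L) (@J2_gens _ _ _ _ L))%FUN.
  have P_surj u : exists t, P t = u by exact: comp_proj_surj.
  have PE : enveloping P.
    apply: enveloping_J2 => t Jt; rewrite /P /=.
      by rewrite (quot_proj_gen Jt) rmorph0.
    by apply: quot_proj_gen; exists t.
  split; last exact: enveloping_noetherian P_surj PE A_noetherian.1 L_fg.
  have -> : @tUrho_filt k A phi f L = fun i => P @` @TL_filt k A phi f L i.
    by apply/funext => i; rewrite /tUrho_filt image_comp.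
  exact: enveloping_almost_commutative.
Qed.
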